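(* Consider the nonlinear initial value problem $u_t=F(t,u,u_x,\dots)$ in $\Omega\times(t_0,t_1]$, $\mathcal{B}u=0$ on $\partial\Omega_b\times(t_0,t_1]$, $u(0)=u_0$, with output $y(t)=\mathcal{H}(u(\cdot,t))$ ($\mathcal{H}$ linear or nonlinear), and an approximation scheme consisting of the ODEs $du^N/dt=F^N(t,u^N)$ in $\mathbb{R}^N$ ($N\ge N_0$), linear maps $P^N$, $\Phi^N$, and norms $\|\cdot\|_N$ on $\mathbb{R}^N$, all as described in the context. Let $W=\mathrm{span}\{e_1,\dots,e_s\}\subseteq D_B$ be the finite-dimensional space for estimation and $W^N=P^N(W)$. Suppose the initial value problem and the approximation scheme are both well posed, that $\Phi^N$ satisfies the Convergence Assumption, and that $\mathcal{H}$ satisfies the Output Continuity Assumption. Let $\rho>0$, let $u$ be a solution of the PDE problem with $u(0)\in W$, and for each $N\ge N_0$ let $u^N$ be the solution of the approximating ODE with $u^N(0)=P^N(u(0))$. Let $\epsilon$ and $\epsilon^N$ be the quantities defined in the context (so that $\rho/\epsilon$ and $\rho/\epsilon^N$ are the unobservability indices of $u(0)$ and $u^N(0)$). Then $$\lim_{N\to\infty}\epsilon^N=\epsilon .$$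
   Context: Setting (PDE). $\Omega\subseteq\mathbb{R}^n$ is open; $(X,\|\cdot\|_X)$ is a Banach space; $D$ is a subspace of $X$; $F$ is a continuous function of $t$, $u$ and the derivatives of $u$ with respect to $x$; $\mathcal{B}$ denotes a set of linear boundary operators on a part $\partial\Omega_b$ of $\partial\Omega$; $D_B=\{v\in D:\mathcal{B}v=0\text{ on }\partial\Omega_b\}$; the initial time is $t_0=0$. Write $u(t)=u(\cdot,t)$. A solution is a continuous function $u:[t_0,t_1]\to X$ such that $du/dt$ exists and is continuous on $(t_0,t_1]$, the equation holds, $u(0)=u_0$, and $u(t)\in D_B$ for all $t\in(t_0,t_1]$. The initial value problem is well posed if for every $u_0\in D_B$ a solution exists, is unique, and depends continuously on its initial value. The output map $\mathcal{H}$ is a mapping, linear or nonlinear, from $X$ to $\mathbb{R}^p$; output functions $y(t)=\mathcal{H}(u(t))$ lie in $C([t_0,t_1])$ (with values in $\mathbb{R}^p$), which carries a norm $\|\cdot\|_Y$. For a function $v:[t_0,t_1]\to X$, $\mathcal{H}(v)$ denotes the function $t\mapsto\mathcal{H}(v(t))$. Space for estimation. $W=\mathrm{span}\{e_1,\dots,e_s\}$ is a subspace of $D_B$ with basis $e_1,\dots,e_s$. Approximation scheme. For $N\ge N_0$: an ODE $du^N/dt=F^N(t,u^N)$, $u^N(0)=u^N_0$, $u^N\in\mathbb{R}^N$, which has a solution on $[t_0,t_1]$ for every initial value in $W^N$; linear mappings $P^N:D\to\mathbb{R}^N$ and $\Phi^N:\mathbb{R}^N\to X$; and a norm $\|\cdot\|_N$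 on $\mathbb{R}^N$. The scheme is well posed if: (i) for any solution $u:[t_0,t_1]\to D_B$ of the PDE problem, if $u^N(t)$ is a solution of the ODE with $u^N(0)=P^N(u(0))$, then $\lim_{N\to\infty}\|\Phi^N(u^N(t))-u(t)\|_X=0$ uniformly on $[t_0,t_1]$; (ii) for any $u\in D$, $\lim_{N\to\infty}\|P^Nu\|_N=\|u\|_X$. Put $e_i^N=P^N(e_i)$ and $W^N=P^N(W)=\mathrm{span}\{e_1^N,\dots,e_s^N\}$. Let $W_E=\mathrm{span}\big(\{e_1,\dots,e_s\}\cup\bigcup_{N\ge N_0}\{\Phi^N(e_1^N),\dots,\Phi^N(e_s^N)\}\big)\subseteq X$. Convergence Assumption for $\Phi^N$. For any sequence $\{\Phi^N(v^N(t))\}_{N\ge N_0}$, where $v^N(t)$ is a solution of $dv^N/dt=F^N(t,v^N)$ with $v^N(0)\in W^N$: if $\Phi^N(v^N(0))$ converges to $u(0)\in W_E$, where $u(t)$ is a solution of the PDE problem, then $\Phi^N(v^N(t))$ converges to $u(t)$ uniformly for $t\in[t_0,t_1]$. Output Continuity Assumption. For every sequence $\{v_k(t)\}_{k\ge k_0}\subset C^1([t_0,t_1],W_E)$ such that $v_k(t)$ converges to $v(t)$ in $W_E$ uniformly on $[t_0,t_1]$, one has $\lim_{k\to\infty}\mathcal{H}(v_k)=\mathcal{H}(v)$ (in $\|\cdot\|_Y$). Definition of $\epsilon$. Given $\rho>0$ and a solution $u$ with $u(0)\in W$, $\epsilon=\inf\|\mathcal{H}(\hat u)-\mathcal{H}(u)\|_Y$,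 the infimum over all $\hat u$ satisfying $\hat u_t=F(t,\hat u,\hat u_x,\dots)$, $\hat u(t)\in D_B$ for all $t\in(t_0,t_1]$, $\hat u(0)\in W$, $\|\hat u(0)-u(0)\|_X=\rho$. Definition of $\epsilon^N$. Given $\rho>0$ and a trajectory $u^N$ of the ODE with $u^N(0)\in W^N$, $\epsilon^N=\inf\|\mathcal{H}\circ\Phi^N(\hat u^N)-\mathcal{H}\circ\Phi^N(u^N)\|_Y$, the infimum over all $\hat u^N$ satisfying $d\hat u^N/dt=F^N(t,\hat u^N)$, $\hat u^N(0)\in W^N$, $\|\hat u^N(0)-u^N(0)\|_N=\rho$.
   Formalization: The Output Continuity Assumption is taken not on W_E but on the span of W_E with all values on [t_0,t_1] of PDE solutions u with u(0) in W and of Φ^N(v^N(t)) with v^N(0) in W^N; with W_E alone the claim is false, since trajectories may leave W_E. *)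

(* Defs.v *)
From HB Require Import structures.
From mathcomp Require Import all_boot all_order all_algebra.
From mathcomp Require Import all_classical all_reals all_analysis.

Set Implicit Arguments.
Unset Strict Implicit.
Unset Printing Implicit Defensive.

Import Order.TTheory GRing.Theory Num.Theory.
Import numFieldNormedType.Exports.

Local Open Scope classical_set_scope.
Local Open Scope ring_scope.

(* MathComp-Analysis.  The time interval is [t_0, t_1] = [0, t1]; a function of
   time is a total function on R of which only the values on [0, t1] matter.  *)

Section LinearAlgebra.
Context (R : realType).

Definition linear_subspace (V : lmodType R) (A : set V) : Prop :=
  A 0 /\ forall (a : R) (v w : V), A v -> A w -> A (a *: v + w).

Definition linear_on (V U : lmodType R) (A : set V) (f : V -> U) : Prop :=
  forall (a : R) (v w : V), A v -> A w -> f (a *: v + w) = a *: f v + f w.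

(* Finite linear combinations of elements of A; no closure is taken. *)
Definition lspan (V : lmodType R) (A : set V) : set V :=
  [set x | exists (k : nat) (c : 'I_k -> R) (a : 'I_k -> V),
    (forall i, A (a i)) /\ x = \sum_(i < k) c i *: a i].

Definition lin_indep (V : lmodType R) (s : nat) (e : 'I_s -> V) : Prop :=
  forall c : 'I_s -> R, \sum_(i < s) c i *: e i = 0 -> forall i, c i = 0.

Definition is_norm (V : lmodType R) (nrm : V -> R) : Prop :=
  [/\ forall v w, nrm (v + w) <= nrm v + nrm w,
      forall a v, nrm (a *: v) = `|a| * nrm v
    & forall v, nrm v = 0 -> v = 0].

End LinearAlgebra.

Section Calculus.
Context (R : realType).

(* Derivative at t relative to I; one-sided at the endpoints of an interval. *)
Definition has_deriv (V : normedModType R) (I : set R) (v : R -> V) (t : R)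
    (d : V) : Prop :=
  (s - t)^-1 *: (v s - v t) @[s --> within I (dnbhs t)] --> d.

(* C^1(I, S), where S carries the norm of V: the derivative lies in S too. *)
Definition C1_on (V : normedModType R) (I : set R) (S : set V) (v : R -> V)
    : Prop :=
  exists dv : R -> V,
    [/\ forall t, I t -> S (v t) /\ S (dv t),
        forall t, I t -> has_deriv I v t (dv t)
      & {within I, continuous dv}].

(* pderiv [:: i1; ..; ik] f = d_{i1} (... (d_{ik} f)). *)
Fixpoint pderiv (n m : nat) (l : seq 'I_n) (f : 'rV[R]_n -> 'rV[R]_m)
    : 'rV[R]_n -> 'rV[R]_m :=
  if l is i :: l' then fun x => 'D_(delta_mx 0 i) (pderiv l' f) x else f.

Fixpoint has_pderiv (n m : nat) (Omega : set 'rV[R]_n) (l : seq 'I_n)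
    (f : 'rV[R]_n -> 'rV[R]_m) : Prop :=
  if l is i :: l' then
    has_pderiv Omega l' f /\
    (forall x, Omega x -> derivable (pderiv l' f) x (delta_mx 0 i))
  else True.

End Calculus.

(* The problem u_t = F(t, u, u_x, ...) in Omega, B u = 0 on the part bdry of the
   boundary of Omega, for R^m-valued u.  The elements of X are functions on
   Omega, possibly up to an equivalence such as equality almost everywhere:
   rep v is the set of the functions that represent v (for v in L^2, the members
   of the class v).  Functions on Omega are total functions of which only the
   values on Omega matter.  The derivatives of u entering F are the d^(alpha j),
   j < q.  A vector-valued boundary operator is given by its components.        *)
Record pde (R : realType) (n m : nat) (X : completeNormedModType R) := Pde {
  Omega : set 'rV[R]_n;
  Omega_open : open Omega;
  rep : X -> set ('rV[R]_n -> 'rV[R]_m);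
  rep_ex : forall v, rep v !=set0;
  rep_inj : forall v w f, rep v f -> rep w f -> v = w;
  rep_lin : forall (a : R) v w f g,
    rep v f -> rep w g -> rep (a *: v + w) (fun x => a *: f x + g x);
  rep_ext : forall v f g,
    (forall x, Omega x -> f x = g x) -> rep v f -> rep v g;
  q : nat;
  alpha : 'I_q -> seq 'I_n;
  rhs : R * 'rV[R]_m * 'M[R]_(q, m) -> 'rV[R]_m;
  rhs_cont : continuous rhs;
  D : set X;
  D_sub : linear_subspace D;
  D_deriv : forall v, D v ->
    exists2 f, rep v f & forall j, has_pderiv Omega (alpha j) f;
  bdry : set 'rV[R]_n;
  bdry_sub : bdry `<=` closure Omega `\` Omega;
  Bop : set (X -> 'rV[R]_n -> R);
  Bop_lin : forall B, Bop B ->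
    forall x, bdry x -> linear_on D (fun v => (B v x : R^o))
}.
Arguments alpha {R n m X} p j : rename.
Arguments rhs {R n m X} p _ : rename.
Arguments rep {R n m X} p v : rename.

Section PdeProblem.
Context (R : realType) (n m : nat) (X : completeNormedModType R).
Variables (E : pde n m X) (t1 : R).

Definition D_B : set X :=
  [set v | D E v /\
    forall B, Bop E B -> forall x, bdry E x -> B v x = 0].

(* w = F(t, v, v_x, ...) as elements of X *)
Definition pde_rhs (t : R) (v w : X) : Prop :=
  exists f : 'rV[R]_n -> 'rV[R]_m,
    [/\ rep E v f,
        forall j, has_pderiv (Omega E) (alpha E j) f
      & rep E w (fun x =>
          rhs E (t, f x, \matrix_(j, k) pderiv (alpha E j) f x 0 k))].

Definition pde_solution (u : R -> X) : Prop :=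
  [/\ {within `[0, t1], continuous u},
      exists du : R -> X,
        {within `]0, t1], continuous du} /\
        forall t, 0 < t <= t1 ->
          has_deriv `[0, t1] u t (du t) /\ pde_rhs t (u t) (du t)
    & forall t, 0 < t <= t1 -> D_B (u t)].

Definition well_posed_ivp : Prop :=
  [/\ forall u0, D_B u0 -> exists2 u, pde_solution u & u 0 = u0,
      forall u w, pde_solution u -> pde_solution w -> D_B (u 0) ->
        u 0 = w 0 -> forall t, 0 <= t <= t1 -> u t = w t
    & forall u, pde_solution u -> D_B (u 0) ->
        forall eps : R, 0 < eps -> exists2 delta : R, 0 < delta &
          forall w, pde_solution w -> D_B (w 0) -> `|w 0 - u 0| < delta ->
            forall t, 0 <= t <= t1 -> `|w t - u t| < eps].

End PdeProblem.

(* The components of index N < N0 are irrelevant. *)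
Record scheme (R : realType) (X : completeNormedModType R) (D : set X) :=
Scheme {
  N0 : nat;
  FN : forall N, R -> 'rV[R]_N -> 'rV[R]_N;
  PN : forall N, X -> 'rV[R]_N;
  PN_lin : forall N, (N0 <= N)%N -> linear_on D (PN N);
  PhiN : forall N, {linear 'rV[R]_N -> X};
  normN : forall N, 'rV[R]_N -> R;
  normN_norm : forall N, (N0 <= N)%N -> is_norm (@normN N)
}.
Arguments FN {R X D} s [N] _ _ : rename.
Arguments PN {R X D} s N _ : rename.
Arguments PhiN {R X D} s N : rename.
Arguments normN {R X D} s [N] _ : rename.

Section Approximation.
Context (R : realType) (n m : nat) (X : completeNormedModType R).
Variables (E : pde n m X) (t1 : R) (A : scheme (D E)).

Definition ode_solution (N : nat) (v : R -> 'rV[R]_N) : Prop :=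
  C1_on `[0, t1] setT v /\
  forall t, 0 <= t <= t1 -> has_deriv `[0, t1] v t (FN A t (v t)).

Definition well_posed_scheme : Prop :=
  (forall (u : R -> X) (uN : forall N, R -> 'rV[R]_N),
     pde_solution E t1 u -> D_B E (u 0) ->
     (forall N, (N0 A <= N)%N ->
        ode_solution (uN N) /\ uN N 0 = PN A N (u 0)) ->
     {uniform `[0, t1], (fun N t => PhiN A N (uN N t)) @ \oo --> u}) /\
  (forall v : X, D E v -> normN A (PN A N v) @[N --> \oo] --> `|v|).

Variables (s : nat) (e : 'I_s -> X).

Definition W : set X := lspan (range e).

Definition WN (N : nat) : set 'rV[R]_N := PN A N @` W.

Definition W_E : set X :=
  lspan (range e `|`
    [set x | exists N i, (N0 A <= N)%N /\ x = PhiN A N (PN A N (e i))]).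

Definition ode_solvable : Prop :=
  forall N, (N0 A <= N)%N -> forall w : 'rV[R]_N, WN w ->
    exists2 v, ode_solution v & v 0 = w.

Definition convergence_assumption : Prop :=
  forall (vN : forall N, R -> 'rV[R]_N) (u : R -> X),
    (forall N, (N0 A <= N)%N -> ode_solution (vN N) /\ WN (vN N 0)) ->
    pde_solution E t1 u -> W_E (u 0) ->
    PhiN A N (vN N 0) @[N --> \oo] --> u 0 ->
    {uniform `[0, t1], (fun N t => PhiN A N (vN N t)) @ \oo --> u}.

(* W_E contains initial values only: neither the solutions u with u(0) in W nor
   the Phi^N(v^N) with v^N(0) in W^N need stay in it for t > 0.  W_E_traj is the
   span of W_E together with the values of these trajectories: continuity of the
   output map along W_E-valued curves alone gives no control of the outputs.   *)
Definition W_E_traj : set X :=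
  lspan (W_E
    `|` [set x | exists u t, [/\ pde_solution E t1 u, W (u 0),
                                 0 <= t <= t1 & x = u t]]
    `|` [set x | exists N (v : R -> 'rV[R]_N) t,
          [/\ (N0 A <= N)%N, ode_solution v, WN (v 0),
              0 <= t <= t1 & x = PhiN A N (v t)]]).

End Approximation.

Section Output.
Context (R : realType) (n m p s : nat) (X : completeNormedModType R).
Variables (E : pde n m X) (t1 : R) (A : scheme (D E)) (e : 'I_s -> X).
Variables (H : X -> 'rV[R]_p) (normY : (R -> 'rV[R]_p) -> R).

(* normY is a norm on C([0, t1], R^p).  The equivalence in the last clause makes
   it depend only on the values on [0, t1].                                    *)
Definition is_output_norm : Prop :=
  [/\ forall y z : R -> 'rV[R]_p, {within `[0, t1], continuous y} ->
        {within `[0, t1], continuous z} ->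
        normY (fun t => y t + z t) <= normY y + normY z,
      forall (a : R) (y : R -> 'rV[R]_p), {within `[0, t1], continuous y} ->
        normY (fun t => a *: y t) = `|a| * normY y
    & forall y : R -> 'rV[R]_p, {within `[0, t1], continuous y} ->
        normY y = 0 <-> (forall t, 0 <= t <= t1 -> y t = 0)].

Definition outputs_continuous : Prop :=
  (forall u, pde_solution E t1 u -> {within `[0, t1], continuous (H \o u)}) /\
  (forall N, (N0 A <= N)%N -> forall v : R -> 'rV[R]_N,
     ode_solution t1 A v -> WN A e (v 0) ->
     {within `[0, t1], continuous (fun t => H (PhiN A N (v t)))}).

Definition output_continuity (S : set X) : Prop :=
  forall (k0 : nat) (vk : nat -> R -> X) (v : R -> X),
    (forall k, (k0 <= k)%N -> C1_on `[0, t1] S (vk k)) ->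
    (forall t, 0 <= t <= t1 -> S (v t)) ->
    {uniform `[0, t1], vk @ \oo --> v} ->
    normY (fun t => H (vk k t) - H (v t)) @[k --> \oo] --> (0 : R).

(* The infimum over an empty set is +oo. *)
Definition epsilon (rho : R) (u : R -> X) : \bar R :=
  ereal_inf [set (normY (fun t => H (u' t) - H (u t)))%:E | u' in
    [set u' | [/\ pde_solution E t1 u', W e (u' 0) & `|u' 0 - u 0| = rho]]].

Definition epsilonN (rho : R) (N : nat) (uN : R -> 'rV[R]_N) : \bar R :=
  ereal_inf [set (normY (fun t => H (PhiN A N (v t)) - H (PhiN A N (uN t))))%:E
    | v in [set v : R -> 'rV[R]_N |
      [/\ ode_solution t1 A v, WN A e (v 0)
        & normN A (v 0 - uN 0) = rho]]].

End Output.

(* Main.v *)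
(* The coefficient vector x in R^s of an element of W carries the seminorms
   g_N(x) = ||P^N (sum_i x_i e_i)||_N, which converge pointwise to the norm
   g(x) = ||sum_i x_i e_i||_X, hence along convergent sequences, and are
   eventually bounded below by c |x|.  If x_N --> x, the Convergence Assumption
   and the continuity of the output map give convergence of the output distance
   of the N-th trajectory started at coefficients x_N to that of the solution
   started at x.  For limsup eps^N <= eps, rescale the increment of an almost
   optimal competitor to have N-norm rho.  For liminf eps^N >= eps, the lower
   bound confines the increments of almost optimal discrete competitors to a
   compact set, so a subsequence converges to some a with g(a) = rho, and a is
   admissible for eps. *)
Require Import Defs.
From HB Require Import structures.
From mathcomp Require Import lra.
From mathcomp Require Import all_boot all_order all_algebra.
From mathcomp Require Import all_classical all_reals all_analysis.
Import Order.TTheory GRing.Theory Num.Theory.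
Import numFieldNormedType.Exports.
Local Open Scope classical_set_scope.
Local Open Scope ring_scope.

Set Implicit Arguments.
Unset Strict Implicit.
Unset Printing Implicit Defensive.

(** * Linear subspaces and spans *)

Section Subspaces.
Context (R : realType).

Lemma linear_subspaceZ (V : lmodType R) (S : set V) : linear_subspace S ->
  forall (a : R) v, S v -> S (a *: v).
Proof. by move=> [S0 SS] a v Sv; rewrite -[_ *: _]addr0; exact: SS. Qed.

Lemma linear_subspace_sum (V : lmodType R) (S : set V) : linear_subspace S ->
  forall (I : Type) (r : seq I) (P : pred I) (F : I -> V),
  (forall i, P i -> S (F i)) -> S (\sum_(i <- r | P i) F i).
Proof.
move=> [S0 SS] I r P F SF; elim/big_ind : _ => // v w Sv Sw.
by rewrite -[v]scale1r; exact: SS.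
Qed.

Lemma lspan_subspace (V : lmodType R) (S : set V) : linear_subspace (lspan S).
Proof.
split.
  exists 0%N, (fun=> 0), (fun=> 0); split; first by case.
  by rewrite big_ord0.
move=> a _ _ [k [c [v [Sv ->]]]] [l [d [w [Sw ->]]]].
exists (k + l)%N,
  (fun i => match fintype.split i with inl j => a * c j | inr j => d j end),
  (fun i => match fintype.split i with inl j => v j | inr j => w j end); split.
  by move=> i; case: (fintype.split i).
rewrite big_split_ord scaler_sumr; congr (_ + _); apply: eq_bigr => i _.
  by rewrite (unsplitK (inl i)) scalerA.
by rewrite (unsplitK (inr i)).
Qed.

Lemma sub_lspan (V : lmodType R) (S : set V) : S `<=` lspan S.
Proof.
move=> v Sv; exists 1%N, (fun=> 1), (fun=> v); split=> //.
by rewrite big_ord_recl big_ord0 addr0 scale1r.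
Qed.

Lemma linear_on0 (V U : lmodType R) (S : set V) (f : V -> U) :
  linear_subspace S -> linear_on S f -> f 0 = 0.
Proof.
move=> [S0 _] /(_ 1 0 0 S0 S0); rewrite !scale1r addr0 => f0.
by apply: (addrI (f 0)); rewrite addr0 -f0.
Qed.

Lemma linear_onZ (V U : lmodType R) (S : set V) (f : V -> U) :
  linear_subspace S -> linear_on S f ->
  forall (a : R) v, S v -> f (a *: v) = a *: f v.
Proof.
move=> SS fl a v Sv; rewrite -[in LHS](addr0 (a *: v)) fl//; last exact: SS.1.
by rewrite (linear_on0 SS fl) addr0.
Qed.

Lemma linear_onD (V U : lmodType R) (S : set V) (f : V -> U) :
  linear_on S f -> forall v w, S v -> S w -> f (v + w) = f v + f w.
Proof. by move=> fl v w Sv Sw; rewrite -[v]scale1r fl// !scale1r. Qed.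

(* C is the cokernel of a matrix B of maximal rank with row space inside S. *)
Lemma linear_subspace_kernel (N : nat) (S : set 'rV[R]_N) :
  linear_subspace S -> exists C : 'M[R]_N, forall x, S x <-> x *m C = 0.
Proof.
move=> SS; pose Q k := `[< exists2 B : 'M[R]_N,
  (forall x : 'rV_N, (x <= B)%MS -> S x) & \rank B = k >].
have Q0 : exists k, Q k.
  exists 0%N; apply/asboolP; exists 0; last by rewrite mxrank0.
  by move=> x; rewrite submx0 => /eqP ->; exact: SS.1.
have QN k : Q k -> (k <= N)%N.
  by move=> /asboolP[B _ <-]; exact: rank_leq_row.
case: (ex_maxnP Q0 QN) => k /asboolP[B BS rB] kmax.
exists (cokermx B) => x; split => [Sx|/eqP]; last first.
  by rewrite -submxE; exact: BS.
apply/eqP; rewrite -submxE; apply/negPn/negP => xB.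
(* If [x] were outside the row space of [B], adjoining it would raise the rank while the row space
   stays in [S], against the maximality of [k]. *)
have : (\rank (B + x)%MS <= k)%N.
  apply: kmax; apply/asboolP; exists (B + x)%MS => // y.
  move=> /sub_addsmxP[[a b]/= ->].
  rewrite -[a *m B]scale1r; apply: SS.2; first by apply: BS; exact: submxMl.
  by rewrite (mx11_scalar b) mul_scalar_mx; exact: linear_subspaceZ.
apply/negP; rewrite -ltnNge -rB; apply: rank_ltmx.
by rewrite /ltmx addsmxSl/= addsmx_sub submx_refl/= xB.
Qed.

End Subspaces.

(** * Limits of finite sums and linear maps on row vectors *)

Section FiniteDimension.
Context (R : realType).

Lemma cvg_sum_seq (T I : Type) (F : set_system T) {FF : Filter F}
    (V : normedModType R) (r : seq I) (f : I -> T -> V) (l : I -> V) :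
  (forall i, f i x @[x --> F] --> l i) ->
  (\sum_(i <- r) f i x) @[x --> F] --> \sum_(i <- r) l i.
Proof.
by move=> fl; apply: cvg_big => [z|i _]; [exact: add_continuous|exact: fl].
Qed.

(** In the canonical basis the map is a finite sum of coordinates times fixed vectors. *)
Lemma linear_rV_continuous N (V : normedModType R)
  (f : {linear 'rV[R]_N -> V}) : continuous f.
Proof.
have [c ->] : exists c : 'I_N -> V, (f : _ -> _) = fun y => \sum_i y 0 i *: c i.
  exists (fun i => f (delta_mx 0 i)); apply/funext => y.
  rewrite [in LHS](row_sum_delta y) linear_sum.
  by apply: eq_bigr => i _; rewrite linearZ.
move=> x; apply: (@cvg_sum_seq _ _ (nbhs x)) => i; apply: cvgZr_tmp.
exact: coord_continuous.
Qed.

End FiniteDimension.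

(** Separates the liminf bound from the limsup bound and covers infinite limits, as an infimum over
    no competitors is +oo. The lower bound is weak because its negation, [f N < r], is what yields a
    competitor below [r]. *)
Lemma cvge_squeeze (R : realType) (f : nat -> \bar R) (l : \bar R) :
  (forall r : R, (r%:E < l)%E -> \forall N \near \oo, (r%:E <= f N)%E) ->
  (forall r : R, (l < r%:E)%E -> \forall N \near \oo, (f N < r%:E)%E) ->
  f N @[N --> \oo] --> l.
Proof.
move=> f_ge f_lt P; case: l f_ge f_lt => [l||] f_ge f_lt.
- move=> Pl; have /nbhs_ballP[d /= d0 dP] : nbhs l (fun r => P r%:E).
    exact: Pl.
  have d2 : d / 2 < d by rewrite ltr_pdivrMr// ltr_pMr// ltr1n.
  have := f_ge (l - d / 2); rewrite lte_fin gtrDl oppr_lt0 divr_gt0//.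
  move=> /(_ isT) f1.
  have := f_lt (l + d / 2); rewrite lte_fin ltrDl divr_gt0// => /(_ isT) f2.
  rewrite nbhs_filterE; suff : \forall N \near \oo, P (f N) by [].
  near=> N.
  have : (f N < (l + d / 2)%:E)%E by near: N.
  have : ((l - d / 2)%:E <= f N)%E by near: N.
  case: (f N) => // r; rewrite lee_fin lte_fin => lr rl.
  by apply: dP; rewrite -ball_normE /= ltr_norml; apply/andP; split; lra.
- move=> [M [_ MP]].
  (* The weak bound at [M + 1] gives the strict bound at [M]. *)
  have := f_ge (M + 1) (ltry _); apply: filterS => N /= MN; apply: MP.
  by apply: lt_le_trans MN; rewrite lte_fin ltrDl.
- move=> [M [_ MP]].
  by have := f_lt M (ltNyr _); apply: filterS => N /= NM; exact: MP.
Unshelve. all: by end_near. Qed.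

(** * Extraction of convergent sequences from compact sets *)

Section CompactSelection.
Context (R : realType) (V : normedModType R).

(* x is a along all indices outside a strictly increasing sequence N_k, where it
   is a 1/(k+1)-close solution of Q. *)
Lemma dense_selection (Q : nat -> V -> Prop) (a : V) :
  (forall (eta : R) M, 0 < eta ->
     exists N x, [/\ (M <= N)%N, `|a - x| < eta & Q N x]) ->
  exists x : nat -> V, x N @[N --> \oo] --> a /\
    forall M, exists2 N, (M <= N)%N & Q N (x N).
Proof.
move=> near_a.
have /choice[f fP] : forall kM : nat * nat, exists Nx : nat * V,
    [/\ (kM.2 <= Nx.1)%N, `|a - Nx.2| < kM.1.+1%:R^-1 & Q Nx.1 Nx.2].
  move=> [k M]; have [|N [x NxP]] := near_a k.+1%:R^-1 M; last by exists (N, x).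
  by rewrite invr_gt0 ltr0n.
(* Each index is sought beyond the previous one, and the tolerance shrinks with [k]. *)
pose g := fix g k := if k is k'.+1 then f (k, (g k').1.+1) else f (0%N, 0%N).
have gP k : `|a - (g k).2| < k.+1%:R^-1 /\ Q (g k).1 (g k).2.
  case: k => [|k] /=; first by have [] := fP (0, 0)%N.
  by have [] := fP (k.+1, (g k).1.+1).
have gS k : ((g k).1 < (g k.+1).1)%N by have [] := fP (k.+1, (g k).1.+1).
have g_incr : {homo (fun k => (g k).1) : k l / (k < l)%N}.
  by apply: homo_ltn => //; exact: ltn_trans.
have g_mono k l : (g k).1 = (g l).1 -> k = l.
  by case: (ltngtP k l) => // /g_incr kl eq_kl; move: kl; rewrite eq_kl ltnn.
have /choice[x xP] : forall N, exists x : V,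
    (forall k, (g k).1 = N -> x = (g k).2) /\
    ((forall k, (g k).1 != N) -> x = a).
  move=> N; have [[k kN]|noN] := pselect (exists k, (g k).1 = N).
    exists (g k).2; split => [l lN|/(_ k)]; last by rewrite kN eqxx.
    by congr (g _).2; apply: g_mono; rewrite lN.
  exists a; split=> // k kN; by case: noN; exists k.
exists x; split; last first.
  move=> M; exists (g M).1; last by rewrite ((xP _).1 M erefl); exact: (gP M).2.
  elim: M => // M IH; exact: leq_ltn_trans (gS M).
apply/cvgrPdist_lt => eta eta0.
have [K Keta] : exists K, K.+1%:R^-1 < eta.
  have [K _ KP] := near_infty_natSinv_lt (PosNum eta0).
  by exists K; exact: (KP K (leqnn K)).
exists (g K).1 => // N /= KN.
have [[k kN]|noN] := pselect (exists k, (g k).1 = N); last first.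
  rewrite (xP N).2 ?subrr ?normr0// => k; apply/eqP => kN.
  by apply: noN; exists k.
rewrite ((xP N).1 k kN); apply: lt_trans (gP k).1 _.
(* Here [K <= k]: otherwise [N], the k-th selected index, would lie before the K-th. *)
apply: le_lt_trans Keta; rewrite lef_pV2 ?posrE ?ltr0n// ler_nat ltnS.
rewrite leqNgt; apply/negP => /g_incr; by rewrite kN ltnNge KN.
Qed.

(** The limit is a cluster point of chosen solutions of [Q]. The result is a full sequence, with [Q]
    holding infinitely often, so that convergence statements indexed by all [N] apply without
    passing to a subsequence. *)
Lemma compact_selection (K : set V) (Q : nat -> V -> Prop) : compact K ->
  (forall M, exists N x, [/\ (M <= N)%N, K x & Q N x]) ->
  exists2 a, K a & exists x : nat -> V, x N @[N --> \oo] --> a /\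
    forall M, exists2 N, (M <= N)%N & Q N (x N).
Proof.
move=> cK freq.
have /choice[f fP] : forall M, exists Nx : nat * V,
    [/\ (M <= Nx.1)%N, K Nx.2 & Q Nx.1 Nx.2].
  by move=> M; have [N [x NxP]] := freq M; exists (N, x).
have [|a [Ka cla]] := cK ((fun M => (f M).2) @ \oo) _.
  by exists 0%N => // M _; have [] := fP M.
exists a => //; apply: dense_selection => eta M eta0.
(* Every tail of the chosen points meets every ball around [a], and [N <= (f N).1] keeps the index
   beyond [M]. *)
have [] := cla [set x | exists2 N, (M <= N)%N & x = (f N).2] (ball a eta).
- by exists M => // N /= MN; exists N.
- exact: nbhsx_ballx.
move=> _ [[N MN ->] aN]; exists (f N).1, (f N).2.
have [? _ ?] := fP N; split=> //.
  exact: leq_trans MN _.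
by move: aN; rewrite -ball_normE.
Qed.

End CompactSelection.

(** * Convergent families of seminorms on row vectors *)

Section Seminorms.
Context (R : realType).

Definition seminorm (V : lmodType R) (g : V -> R) : Prop :=
  (forall v w, g (v + w) <= g v + g w) /\
  (forall a v, g (a *: v) = `|a| * g v).

Lemma seminorm0 (V : lmodType R) (g : V -> R) : seminorm g -> g 0 = 0.
Proof. by move=> [_ gZ]; rewrite -(scale0r 0) gZ normr0 mul0r. Qed.

Lemma seminormN (V : lmodType R) (g : V -> R) : seminorm g ->
  forall v, g (- v) = g v.
Proof. by move=> [_ gZ] v; rewrite -scaleN1r gZ normrN1 mul1r. Qed.

Lemma seminorm_ge0 (V : lmodType R) (g : V -> R) : seminorm g ->
  forall v, 0 <= g v.
Proof.
move=> gS v; have := gS.1 v (- v).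
by rewrite subrr (seminorm0 gS) (seminormN gS) -mulr2n pmulrn_lge0.
Qed.

Lemma seminorm_dist (V : lmodType R) (g : V -> R) : seminorm g ->
  forall v w, `|g v - g w| <= g (v - w).
Proof.
move=> gS v w; rewrite ler_norml; apply/andP; split.
  have := gS.1 (- (v - w)) v; rewrite (seminormN gS) opprB subrK => wv.
  by rewrite lerNl opprB lerBlDr.
by have := gS.1 (v - w) w; rewrite subrK lerBlDr.
Qed.

Lemma seminorm_rV_le s (g : 'rV[R]_s -> R) : seminorm g ->
  forall x, g x <= \sum_i `|x 0 i| * g (delta_mx 0 i).
Proof.
move=> gS x; rewrite [in leLHS](row_sum_delta x).
elim/big_ind2 : _ => [|a b c d ab cd|i _]; first by rewrite (seminorm0 gS).
  by apply: le_trans (gS.1 _ _) _; exact: lerD.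
by rewrite gS.2.
Qed.

(** The difference of [g_ N (x N)] and [g_ N a] is at most the sum of the coordinates of [x N - a]
    in absolute value, weighted by [g_ N] of the basis vectors; these weights converge, so the sum
    tends to 0. A constant family gives the continuity of a seminorm. *)
Lemma seminorm_cvg (T : Type) (F : set_system T) {FF : Filter F} s
    (g_ : T -> 'rV[R]_s -> R) (g : 'rV[R]_s -> R) :
  (\forall N \near F, seminorm (g_ N)) ->
  (forall x, g_ N x @[N --> F] --> g x) ->
  forall (x : T -> 'rV[R]_s) a, x N @[N --> F] --> a ->
  g_ N (x N) @[N --> F] --> g a.
Proof.
move=> gS g_cvg x a xa.
have dist0 : (\sum_i `|(x N - a) 0 i| * g_ N (delta_mx 0 i)) @[N --> F] -->
    (\sum_(i < s) 0 * g (delta_mx 0 i)).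
  apply: (@cvg_sum_seq _ _ _ F _ R^o) => i; apply: cvgM; last exact: g_cvg.
  have xai : (x N - a) 0 i @[N --> F] --> (a - a) 0 i.
    apply: (cvg_comp (fun N => x N - a) (fun y : 'rV[R]_s => y 0 i) _
      (@coord_continuous R 1 s 0 i (a - a))).
    by apply: cvgB xa _; exact: cvg_cst.
  by move/cvg_norm : xai; rewrite subrr mxE normr0.
rewrite big1 in dist0; last by move=> i _; rewrite mul0r.
apply/cvgrPdist_le => eta eta0.
have e2 : 0 < eta / 2 by rewrite divr_gt0.
move/cvgrPdist_le : dist0 => /(_ _ e2) d0.
move/cvgrPdist_le : (g_cvg a) => /(_ _ e2) ga.
near=> N.
rewrite -[g a](subrK (g_ N a)) -addrA (splitr eta).
apply: le_trans (ler_normD _ _) _; apply: lerD; first by near: N.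
have gSN : seminorm (g_ N) by near: N.
apply: le_trans (seminorm_dist gSN _ _) _; rewrite -opprB (seminormN gSN).
apply: le_trans (seminorm_rV_le gSN _) _.
have : `|0 - \sum_i `|(x N - a) 0 i| * g_ N (delta_mx 0 i)| <= eta / 2.
  by near: N.
by rewrite sub0r normrN; exact/le_trans/ler_norm.
Unshelve. all: by end_near. Qed.

(** On the unit sphere [g] has a positive minimum [c]. If the bound [c / 2] failed infinitely often,
    unit vectors violating it would accumulate at some [a] with [g a <= c / 2]. *)
Lemma seminorm_eventually_bounded_below s (g_ : nat -> 'rV[R]_s -> R)
    (g : 'rV[R]_s -> R) :
  (\forall N \near \oo, seminorm (g_ N)) ->
  (forall x, g_ N x @[N --> \oo] --> g x) ->
  seminorm g -> (forall x, g x = 0 -> x = 0) ->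
  exists2 c, 0 < c & \forall N \near \oo, forall x, c * `|x| <= g_ N x.
Proof.
move=> gNS g_cvg gS g_pos.
have cS : compact [set x : 'rV[R]_s | `|x| = 1].
  apply: bounded_closed_compact.
    by exists 1; split => // M M1 x /= ->; exact: ltW.
  apply: (closed_comp (f := fun x : 'rV[R]_s => `|x|) (D := [set 1])).
    by move=> x _; exact: norm_continuous.
  exact: closed_eq.
have [c c0 cg] : exists2 c, 0 < c & forall x : 'rV[R]_s, `|x| = 1 -> c <= g x.
  (* The sphere is empty when [s = 0]; any positive constant then serves. *)
  have [S1|noS] := pselect (exists x : 'rV[R]_s, `|x| = 1); last first.
    by exists 1 => // x x1; case: noS; exists x.
  have [|a /set_mem/= a1 ga] := compact_EVT_min (f := g) S1 cS.
    apply: continuous_subspaceT => x.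
    apply: (@seminorm_cvg _ (nbhs x) _ _ (fun=> g)) => //.
    - exact: nearW.
    - by move=> y; exact: cvg_cst.
  exists (g a) => [|x x1]; last by apply: ga; exact/mem_set.
  rewrite lt_def (seminorm_ge0 gS) andbT; apply/eqP => /g_pos a0.
  by move: a1; rewrite a0 normr0 => /esym/eqP; rewrite oner_eq0.
exists (c / 2); first exact: divr_gt0.
apply: contrapT => noN.
have [] := @compact_selection _ _ _ (fun N x => g_ N x < c / 2) cS.
  move=> M; apply: contrapT => noM; apply: noN.
  near=> N => x; have gSN : seminorm (g_ N) by near: N.
  have [->|x0] := eqVneq x 0; first by rewrite normr0 mulr0 (seminorm0 gSN).
  rewrite -ler_pdivlMr ?normr_gt0// leNgt; apply/negP => gx.
  (* By homogeneity a violation of the bound can be moved to the unit sphere. *)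
  apply: noM; exists N, (`|x|^-1 *: x); split.
    + by near: N; exact: nbhs_infty_ge.
    + by rewrite /= normrZ normfV normr_id mulVf// normr_eq0.
    + by rewrite gSN.2 normfV normr_id mulrC.
move=> a /= a1 [x [xa xfreq]].
have ga : c / 2 < g a.
  by apply: lt_le_trans (cg _ a1); rewrite ltr_pdivrMr// ltr_pMr// ltr1n.
have gx : g_ N (x N) @[N --> \oo] --> g a by exact: seminorm_cvg.
move/cvgrPdist_lt : gx => /(_ (g a - c / 2)); rewrite subr_gt0.
move=> /(_ ga) [M _ MP]; have [N MN gN] := xfreq M.
have := MP N MN => /=; rewrite ltr_norml => /andP[_].
by rewrite ltrD2l ltrN2 => /lt_trans/(_ gN); rewrite ltxx.
Unshelve. all: by end_near. Qed.

End Seminorms.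

(** * Coordinates on the space for estimation *)

Section LinearCombinations.
Context (R : realType) (V : normedModType R) (s : nat) (e : 'I_s -> V).

Definition lincomb (x : 'rV[R]_s) : V := \sum_i x 0 i *: e i.

Lemma lincomb_is_linear : linear lincomb.
Proof.
move=> a x y; rewrite /lincomb scaler_sumr -big_split /=.
by apply: eq_bigr => i _; rewrite !mxE scalerDl scalerA.
Qed.
HB.instance Definition _ :=
  GRing.isLinear.Build R 'rV[R]_s V *:%R lincomb lincomb_is_linear.

Lemma lincomb_delta i : lincomb (delta_mx 0 i) = e i.
Proof.
rewrite /lincomb (bigD1 i)//= big1 ?addr0 => [|j ji]; rewrite mxE eqxx /=.
  by rewrite eqxx scale1r.
by rewrite (negPf ji) scale0r.
Qed.

Lemma lspan_range : lspan (range e) = range lincomb.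
Proof.
apply/seteqP; split=> [_ [k [c [a [ae ->]]]]|_ [x _ <-]]; last first.
  by apply: (linear_subspace_sum (lspan_subspace _)) => i _;
    apply: (linear_subspaceZ (lspan_subspace _)); apply: sub_lspan; exists i.
have /choice[j jP] : forall i, exists j, a i = e j.
  by move=> i; have [j _ <-] := ae i; exists j.
exists (\sum_(i < k) c i *: delta_mx 0 (j i)) => //.
rewrite linear_sum; apply: eq_bigr => i _.
by rewrite linearZ/= lincomb_delta jP.
Qed.

Lemma lincomb_eq0 : lin_indep e -> forall x, lincomb x = 0 -> x = 0.
Proof.
by move=> eI x x0; apply/rowP => i; rewrite mxE; exact: (eI (x 0)).
Qed.

Lemma linear_on_lincomb (U : lmodType R) (S : set V) (f : V -> U) :
  linear_subspace S -> linear_on S f -> (forall i, S (e i)) ->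
  forall x, f (lincomb x) = \sum_i x 0 i *: f (e i).
Proof.
move=> SS fl Se x.
(* Membership in [S] is carried through the induction, as [f] is linear on [S] only. *)
suff : S (lincomb x) /\ f (lincomb x) = \sum_i x 0 i *: f (e i) by case.
rewrite /lincomb; elim/big_ind2 : _ => [|v' v w' w [Sv <-] [Sw <-]|i _].
- by split; [exact: SS.1|exact: linear_on0 fl].
- split; last by rewrite (linear_onD fl).
  by rewrite -[v]scale1r; exact: SS.2.
- by split; [exact: linear_subspaceZ|exact: linear_onZ fl _ _ _].
Qed.

End LinearCombinations.

(** * Derivatives relative to the time interval *)

Section Derivatives.
Context (R : realType) (t1 : R).
Hypothesis t1_gt0 : 0 < t1.

(** As [0 < t1], the point [t] is approached from the right if [t < t1] and from the left if
    [t = t1]. Properness is what makes limits of difference quotients stay in closed sets. *)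
Lemma within_itv_dnbhs_proper (t : R) : 0 <= t <= t1 ->
  ProperFilter (within `[0, t1] (dnbhs t)).
Proof.
move=> /andP[t0 tt1]; apply: Build_ProperFilter_ex => A.
rewrite /within/= /dnbhs /within /= => /nbhs_ballP[d /= d0 dA].
have [t_lt|t_ge] := ltP t t1.
  pose k := t + Num.min (d / 2) (t1 - t).
  have k0 : 0 < Num.min (d / 2) (t1 - t) by rewrite lt_min divr_gt0//= subr_gt0.
  exists k; apply: dA; rewrite /k.
  - rewrite -ball_normE /= opprD addNKr normrN gtr0_norm//.
    by rewrite gt_min ltr_pdivrMr// ltr_pMr// ltr1n.
  - by rewrite gt_eqF// ltrDl.
  - rewrite in_itv /= (addr_ge0 t0 (ltW k0)) /=.
    by rewrite -lerBrDl ge_min lexx orbT.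
pose k := t - Num.min (d / 2) t.
have t0' : 0 < t by exact: lt_le_trans t1_gt0 _.
have k0 : 0 < Num.min (d / 2) t by rewrite lt_min divr_gt0.
exists k; apply: dA; rewrite /k.
- rewrite -ball_normE /= opprD addNKr opprK gtr0_norm//.
  by rewrite gt_min ltr_pdivrMr// ltr_pMr// ltr1n.
- by rewrite lt_eqF// gtrDl oppr_lt0.
- rewrite in_itv /= subr_ge0 ge_min lexx orbT /=.
  by apply: le_trans tt1; rewrite gerDl oppr_le0; exact: ltW.
Qed.

Lemma has_deriv_linear N (V : normedModType R) (f : {linear 'rV[R]_N -> V})
    (v : R -> 'rV[R]_N) t d :
  has_deriv `[0, t1] v t d -> has_deriv `[0, t1] (fun r => f (v r)) t (f d).
Proof.
move=> vd; rewrite /has_deriv.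
under eq_fun do rewrite -linearB -linearZ /=.
exact: (cvg_comp _ _ vd (@linear_rV_continuous _ _ _ f d)).
Qed.

(** Writing [S] as the kernel of a matrix [C], the difference quotients of [v] are annihilated by
    [C], hence so is their limit. *)
Lemma has_deriv_subspace N (S : set 'rV[R]_N) (v : R -> 'rV[R]_N) t d :
  linear_subspace S -> (forall r, 0 <= r <= t1 -> S (v r)) -> 0 <= t <= t1 ->
  has_deriv `[0, t1] v t d -> S d.
Proof.
move=> SS Sv tI vd; have [C CP] := linear_subspace_kernel SS; apply/CP.
have PF := within_itv_dnbhs_proper tI.
have vdC := has_deriv_linear (f := mulmxr C) vd; rewrite /has_deriv /= in vdC.
apply: (@closed_cvg _ _ _ PF _ [set 0 : 'rV[R]_N] _ _ _ vdC).
  apply: accessible_closed_set1; apply: hausdorff_accessible.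
  exact: norm_hausdorff.
near=> r; rewrite /= (CP (v r)).1 ?(CP (v t)).1 ?subrr ?scaler0//.
  exact: Sv.
have : `[0, t1]%classic r by near: r; exact: withinT.
by rewrite /= in_itv /=; exact: Sv.
Unshelve. all: by end_near. Qed.

End Derivatives.

(** * Distances in the output norm *)

Section OutputNorm.
Context (R : realType) (p : nat) (t1 : R) (normY : (R -> 'rV[R]_p) -> R).
Hypothesis normY_norm : is_output_norm t1 normY.

Let cont (y : R -> 'rV[R]_p) := {within `[0, t1], continuous y}.

Lemma normY_distC (y z : R -> 'rV[R]_p) : cont y -> cont z ->
  normY (fun t => y t - z t) = normY (fun t => z t - y t).
Proof.
move=> cy cz; have [_ normZ _] := normY_norm.
have := normZ (-1) _ (within_continuousB cz cy).
rewrite normrN1 mul1r => <-; congr normY; apply/funext => t.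
by rewrite scaleN1r opprB.
Qed.

Lemma normY_triangle (x y z : R -> 'rV[R]_p) : cont x -> cont y -> cont z ->
  normY (fun t => x t - z t) <=
  normY (fun t => x t - y t) + normY (fun t => y t - z t).
Proof.
move=> cx cy cz; have [normD _ _] := normY_norm.
have := normD _ _ (within_continuousB cx cy) (within_continuousB cy cz).
rewrite (_ : (fun t => x t - y t + (y t - z t)) = (fun t => x t - z t))//.
by apply/funext => t; rewrite addrA subrK.
Qed.

Lemma normY_dist_cvg (y_ z_ : nat -> R -> 'rV[R]_p) (y z : R -> 'rV[R]_p) :
  (\forall k \near \oo, cont (y_ k)) -> (\forall k \near \oo, cont (z_ k)) ->
  cont y -> cont z ->
  normY (fun t => y_ k t - y t) @[k --> \oo] --> (0 : R) ->
  normY (fun t => z_ k t - z t) @[k --> \oo] --> (0 : R) ->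
  normY (fun t => y_ k t - z_ k t) @[k --> \oo] --> normY (fun t => y t - z t).
Proof.
move=> cy_ cz_ cy cz yk zk; apply/cvgrPdist_le => eta eta0.
have yzk : normY (fun t => y_ k t - y t) + normY (fun t => z_ k t - z t)
    @[k --> \oo] --> (0 + 0 : R) by exact: cvgD.
move/cvgrPdist_le : yzk => /(_ _ eta0) yzk.
near=> k.
have cyk : cont (y_ k) by near: k.
have czk : cont (z_ k) by near: k.
have : `|0 + 0 -
  (normY (fun t => y_ k t - y t) + normY (fun t => z_ k t - z t))| <= eta.
  by near: k.
rewrite addr0 sub0r normrN => /(le_trans (ler_norm _)) yz.
(* [h1] and [h2] bound the limit distance by the k-th one plus the two errors; [h3] and [h4] give
   the converse bound. *)
have h1 := normY_triangle cy cyk cz.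
have h2 := normY_triangle cyk czk cz.
have h3 := normY_triangle cyk cy czk.
have h4 := normY_triangle cy cz czk.
move: h1 h3; rewrite (normY_distC cy cyk) => h1 h3.
move: h4; rewrite (normY_distC cz czk) => h4.
by rewrite ler_norml; apply/andP; split; lra.
Unshelve. all: by end_near. Qed.

End OutputNorm.

(** * The space for estimation and trajectories starting in its projections *)

Section Convergence.
Context (R : realType) (n m p s : nat) (X : completeNormedModType R) (t1 : R).
Hypothesis t1_gt0 : 0 < t1.
Context (E : pde n m X) (e : 'I_s -> X).
Hypothesis e_D_B : forall i, D_B E (e i).
Context (A : scheme (D E)).
Hypothesis A_solvable : ode_solvable t1 A e.

Lemma D_B_subspace : linear_subspace (D_B E).
Proof.
have DS := D_sub E; split.
  split; first exact: DS.1.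
  move=> B BB x bx.
  exact: (linear_on0 (f := fun v => B v x : R^o) DS (Bop_lin BB bx)).
move=> a v w [Dv Bv] [Dw Bw]; split; first exact: DS.2.
move=> B BB x bx; have := Bop_lin BB bx a Dv Dw.
by rewrite Bv// Bw// scaler0 addr0.
Qed.

Lemma W_lincombP v : W e v <-> exists x, v = lincomb e x.
Proof.
rewrite /W lspan_range; split=> [[x _ <-]|[x ->]]; last by exists x.
by exists x.
Qed.

Lemma W_lincomb x : W e (lincomb e x).
Proof. by apply/W_lincombP; exists x. Qed.

Lemma W_sub_D_B v : W e v -> D_B E v.
Proof.
move=> /W_lincombP[x ->]; apply: (linear_subspace_sum D_B_subspace) => i _.
exact: (linear_subspaceZ D_B_subspace).
Qed.

Lemma W_sub_W_E : W e `<=` W_E A e.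
Proof.
move=> v /W_lincombP[x ->].
apply: (linear_subspace_sum (lspan_subspace _)) => i _.
apply: (linear_subspaceZ (lspan_subspace _)); apply: sub_lspan.
by left; exists i.
Qed.

Lemma W_E_traj_subspace : linear_subspace (W_E_traj t1 A e).
Proof. exact: lspan_subspace. Qed.

Lemma PN_lincomb N x : (N0 A <= N)%N ->
  PN A N (lincomb e x) = \sum_i x 0 i *: PN A N (e i).
Proof.
move=> AN; apply: (linear_on_lincomb (D_sub E) (PN_lin AN)) => i.
by case: (e_D_B i).
Qed.

Lemma PN_WD N v w : (N0 A <= N)%N -> W e v -> W e w ->
  PN A N (v + w) = PN A N v + PN A N w.
Proof.
move=> AN Wv Ww; apply: (linear_onD (PN_lin AN)).
  by case: (W_sub_D_B Wv).
by case: (W_sub_D_B Ww).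
Qed.

(* The derivative stays in W_E_traj because the preimage of W_E_traj under Phi^N
   is a subspace of R^N, hence closed; W_E_traj itself need not be closed. *)
Lemma C1_traj N (v : R -> 'rV[R]_N) : (N0 A <= N)%N ->
  ode_solution t1 A v -> WN A e (v 0) ->
  C1_on `[0, t1] (W_E_traj t1 A e) (fun t => PhiN A N (v t)).
Proof.
move=> AN v_sol v0; have [[dv [_ v_dv dv_cont]] _] := v_sol.
pose S := [set x | W_E_traj t1 A e (PhiN A N x)].
have SS : linear_subspace S.
  split; first by rewrite /S /= linear0; exact: W_E_traj_subspace.1.
  by move=> a x y; rewrite /S /= linearP; exact: W_E_traj_subspace.2.
have Sv t : 0 <= t <= t1 -> S (v t).
  by move=> tI; apply: sub_lspan; right; exists N, v, t.
have itvP t : `[0, t1]%classic t = (0 <= t <= t1) by rewrite /= in_itv.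
exists (fun t => PhiN A N (dv t)); split.
- move=> t tI; split; first by apply: Sv; rewrite -itvP.
  apply: (has_deriv_subspace t1_gt0 SS Sv); last exact: v_dv.
  by rewrite -itvP.
- by move=> t tI; apply: has_deriv_linear; exact: v_dv.
- move=> t; apply: (cvg_comp _ _ (dv_cont t)).
  exact: linear_rV_continuous.
Qed.

Lemma uniform_cvg_at (V : normedModType R) (v_ : nat -> R -> V) (v : R -> V) t :
  0 <= t <= t1 -> {uniform `[0, t1], v_ @ \oo --> v} ->
  v_ N t @[N --> \oo] --> v t.
Proof.
move=> tI v_cvg; apply/cvgrPdist_lt => eta eta0.
have : nbhs (v : {uniform` `[0, t1] -> V})
    [set h | forall r, `[0, t1]%classic r -> ball (v r) eta (h r)].
  apply/uniform_nbhs; exists [set vw | ball vw.1 eta vw.2]; split=> //.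
  exact: (entourage_ball _ (PosNum eta0)).
move=> /v_cvg[M _ MP]; exists M => // N /= MN.
have := MP N MN t; rewrite -ball_normE/= in_itv/=; exact.
Qed.

(** * Convergence of the approximating trajectories *)

Hypothesis ivp_well_posed : well_posed_ivp E t1.
Hypothesis scheme_well_posed : well_posed_scheme t1 A.

Lemma traj_choice (w : nat -> X) : (forall N, W e (w N)) ->
  exists v : forall N, R -> 'rV[R]_N, forall N, (N0 A <= N)%N ->
    ode_solution t1 A (v N) /\ v N 0 = PN A N (w N).
Proof.
move=> Ww.
have vP N : {v : R -> 'rV[R]_N | (N0 A <= N)%N ->
    ode_solution t1 A v /\ v 0 = PN A N (w N)}.
  apply: cid; have [AN|] := leqP (N0 A) N; last first.
    (* A dummy value for the irrelevant dimensions below [N0]. *)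
    by exists (fun=> 0) => // AN.
  have [|v] := A_solvable AN (w := PN A N (w N)); first by exists (w N).
  by exists v.
by exists (fun N => sval (vP N)) => N; exact: (svalP (vP N)).
Qed.

(** Convergence of the scheme along the solution started at [w], read at time 0. *)
Lemma PhiP_cvg w : W e w -> PhiN A N (PN A N w) @[N --> \oo] --> w.
Proof.
move=> Ww; have [v vP] := traj_choice (fun=> Ww).
have [ex _ _] := ivp_well_posed; have [u u_sol u0] := ex w (W_sub_D_B Ww).
have := scheme_well_posed.1 u v u_sol; rewrite u0 => /(_ (W_sub_D_B Ww) vP).
have tI : 0 <= (0 : R) <= t1 by rewrite lexx ltW.
move=> /(uniform_cvg_at tI); rewrite u0; apply: cvg_trans; apply: near_eq_cvg.
by exists (N0 A) => // N /= AN; rewrite (vP N AN).2.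
Qed.

Lemma PhiP_lincomb_cvg (x : nat -> 'rV[R]_s) a : x N @[N --> \oo] --> a ->
  PhiN A N (PN A N (lincomb e (x N))) @[N --> \oo] --> lincomb e a.
Proof.
move=> xa.
have : (\sum_i x N 0 i *: PhiN A N (PN A N (e i))) @[N --> \oo] --> lincomb e a.
  apply: (@cvg_sum_seq _ _ _ \oo) => i; apply: cvgZ.
    exact: (cvg_comp _ _ xa (@coord_continuous R 1 s 0 i a)).
  apply: PhiP_cvg; rewrite -(lincomb_delta e); exact: W_lincomb.
apply: cvg_trans; apply: near_eq_cvg; exists (N0 A) => // N /= AN.
by rewrite PN_lincomb// linear_sum; apply: eq_bigr => i _; rewrite linearZ.
Qed.

Hypothesis Phi_conv : convergence_assumption t1 A e.

(** The initial value moves with [N], so the Convergence Assumption is used in place of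
    well-posedness of the scheme; [PhiP_lincomb_cvg] supplies the convergence at time 0. *)
Lemma traj_cvg (x : nat -> 'rV[R]_s) a (v : forall N, R -> 'rV[R]_N) w :
  x N @[N --> \oo] --> a ->
  (forall N, (N0 A <= N)%N ->
    ode_solution t1 A (v N) /\ v N 0 = PN A N (lincomb e (x N))) ->
  pde_solution E t1 w -> w 0 = lincomb e a ->
  {uniform `[0, t1], (fun N t => PhiN A N (v N t)) @ \oo --> w}.
Proof.
move=> xa vP w_sol w0; apply: Phi_conv => //.
- move=> N AN; have [v_sol v0] := vP N AN; split=> //.
  by rewrite v0; exists (lincomb e (x N)) => //; exact: W_lincomb.
- by apply: W_sub_W_E; rewrite w0; exact: W_lincomb.
- rewrite w0; apply: cvg_trans (PhiP_lincomb_cvg xa); apply: near_eq_cvg.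
  by exists (N0 A) => // N /= AN; rewrite (vP N AN).2.
Qed.

(** * Convergence of the outputs and of the projected norms *)

Context (H : X -> 'rV[R]_p) (normY : (R -> 'rV[R]_p) -> R).
Hypothesis H_cont : output_continuity t1 H normY (W_E_traj t1 A e).

Lemma output_cvg (x : nat -> 'rV[R]_s) a (v : forall N, R -> 'rV[R]_N) w :
  x N @[N --> \oo] --> a ->
  (forall N, (N0 A <= N)%N ->
    ode_solution t1 A (v N) /\ v N 0 = PN A N (lincomb e (x N))) ->
  pde_solution E t1 w -> w 0 = lincomb e a ->
  normY (fun t => H (PhiN A N (v N t)) - H (w t)) @[N --> \oo] --> (0 : R).
Proof.
move=> xa vP w_sol w0; apply: (H_cont (k0 := N0 A)).
- move=> N AN; have [v_sol v0] := vP N AN; apply: C1_traj => //.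
  by rewrite v0; exists (lincomb e (x N)) => //; exact: W_lincomb.
- move=> t tI; apply: sub_lspan; left; right; exists w, t; split=> //.
  by rewrite w0; exact: W_lincomb.
- exact: traj_cvg xa vP w_sol w0.
Qed.

Hypothesis normY_norm : is_output_norm t1 normY.
Hypothesis H_outputs : outputs_continuous t1 A e H.

Lemma output_dist_cvg (x y : nat -> 'rV[R]_s) a b
    (v v' : forall N, R -> 'rV[R]_N) w w' :
  x N @[N --> \oo] --> a -> y N @[N --> \oo] --> b ->
  (forall N, (N0 A <= N)%N ->
    ode_solution t1 A (v N) /\ v N 0 = PN A N (lincomb e (x N))) ->
  (forall N, (N0 A <= N)%N ->
    ode_solution t1 A (v' N) /\ v' N 0 = PN A N (lincomb e (y N))) ->
  pde_solution E t1 w -> w 0 = lincomb e a ->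
  pde_solution E t1 w' -> w' 0 = lincomb e b ->
  normY (fun t => H (PhiN A N (v N t)) - H (PhiN A N (v' N t))) @[N --> \oo] -->
  normY (fun t => H (w t) - H (w' t)).
Proof.
move=> xa yb vP v'P w_sol w0 w'_sol w'0.
have contN (z : nat -> 'rV[R]_s) (f : forall N, R -> 'rV[R]_N) :
    (forall N, (N0 A <= N)%N ->
      ode_solution t1 A (f N) /\ f N 0 = PN A N (lincomb e (z N))) ->
    \forall N \near \oo,
      {within `[0, t1], continuous (fun t => H (PhiN A N (f N t)))}.
  move=> fP; exists (N0 A) => // N /= AN; have [f_sol f0] := fP N AN.
  apply: H_outputs.2 => //; rewrite f0; exists (lincomb e (z N)) => //.
  exact: W_lincomb.
apply: (normY_dist_cvg normY_norm).
- exact: contN vP.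
- exact: contN v'P.
- exact: H_outputs.1.
- exact: H_outputs.1.
- exact: output_cvg xa vP w_sol w0.
- exact: output_cvg yb v'P w'_sol w'0.
Qed.

(** Definiteness is not claimed: [PN A N] may send nonzero elements of [W] to 0. *)
Lemma normN_lincomb_seminorm N : (N0 A <= N)%N ->
  seminorm (fun x => normN A (PN A N (lincomb e x))).
Proof.
move=> AN; have [normD normZ _] := normN_norm AN; split=> [x y|a x].
  by rewrite linearD PN_WD//; exact: W_lincomb.
rewrite linearZ /= (linear_onZ (D_sub E) (PN_lin AN)) ?normZ//.
by case: (W_sub_D_B (W_lincomb x)).
Qed.

Lemma normN_lincomb_cvg x :
  normN A (PN A N (lincomb e x)) @[N --> \oo] --> `|lincomb e x|.
Proof. by apply: scheme_well_posed.2; case: (W_sub_D_B (W_lincomb x)). Qed.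

End Convergence.

(** * Convergence of the infima *)

Theorem theorem2 (R : realType) (n m p s : nat) (X : completeNormedModType R)
  (t1 : R) (t1_gt0 : 0 < t1)
  (E : pde n m X)
  (H : X -> 'rV[R]_p)
  (normY : (R -> 'rV[R]_p) -> R) (normY_norm : is_output_norm t1 normY)
  (e : 'I_s -> X) (e_D_B : forall i, D_B E (e i)) (e_basis : lin_indep e)
  (A : scheme (D E)) (A_solvable : ode_solvable t1 A e)
  (H_outputs : outputs_continuous t1 A e H)
  (ivp_well_posed : well_posed_ivp E t1)
  (scheme_well_posed : well_posed_scheme t1 A)
  (Phi_conv : convergence_assumption t1 A e)
  (H_cont : output_continuity t1 H normY (W_E_traj t1 A e))
  (rho : R) (rho_gt0 : 0 < rho)
  (u : R -> X) (u_sol : pde_solution E t1 u) (u0_W : W e (u 0))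
  (uN : forall N, R -> 'rV[R]_N)
  (uN_sol : forall N, (N0 A <= N)%N ->
     ode_solution t1 A (uN N) /\ uN N 0 = PN A N (u 0)) :
  epsilonN t1 A e H normY rho (uN N) @[N --> \oo]
    --> epsilon E t1 e H normY rho u.
Proof.
have [b u0] := (W_lincombP _ _).1 u0_W.
pose g_ N x := normN A (PN A N (lincomb e x)).
pose g x := `|lincomb e x|.
have g_S : \forall N \near \oo, seminorm (g_ N).
  by exists (N0 A) => // N /= AN; exact: normN_lincomb_seminorm.
have g_cvg x : g_ N x @[N --> \oo] --> g x.
  exact: (normN_lincomb_cvg e_D_B scheme_well_posed).
have uN_sol' N : (N0 A <= N)%N ->
    ode_solution t1 A (uN N) /\ uN N 0 = PN A N (lincomb e b).
  by rewrite -u0; exact: uN_sol.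
(* Here [x N] and [a] are coefficients of increments relative to [u 0], whose own coefficients are
   [b]. *)
have J_cvg (x : nat -> 'rV[R]_s) a (v : forall N, R -> 'rV[R]_N) w :
    x N @[N --> \oo] --> a ->
    (forall N, (N0 A <= N)%N ->
      ode_solution t1 A (v N) /\ v N 0 = PN A N (lincomb e (b + x N))) ->
    pde_solution E t1 w -> w 0 = lincomb e (b + a) ->
    normY (fun t => H (PhiN A N (v N t)) - H (PhiN A N (uN N t)))
      @[N --> \oo] -->
    normY (fun t => H (w t) - H (u t)).
  move=> xa vP w_sol w0.
  apply: (output_dist_cvg t1_gt0 e_D_B A_solvable ivp_well_posed
    scheme_well_posed Phi_conv H_cont normY_norm H_outputs
    (x := fun N => b + x N)
    (y := fun=> b) (a := b + a) (b := b)) => //.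
    by apply: cvgD xa; exact: cvg_cst.
  exact: cvg_cst.
have PND N (x : 'rV[R]_s) : (N0 A <= N)%N ->
    PN A N (lincomb e (b + x)) = uN N 0 + PN A N (lincomb e x).
  move=> AN; rewrite linearD (PN_WD e_D_B)//; try exact: W_lincomb.
  by rewrite (uN_sol' N AN).2.
apply: cvge_squeeze => r.
(* Lower bound: assume that [epsilonN] is below [r] for arbitrarily large [N]. [Q] records a witness
   trajectory, since the ODE may have several solutions with the same initial value. *)
- move=> r_lt; apply: contrapT => not_near.
  pose Q N (x : 'rV[R]_s) := (N0 A <= N)%N /\ exists v, [/\ ode_solution t1 A v,
    v 0 = PN A N (lincomb e (b + x)), g_ N x = rho &
    normY (fun t => H (PhiN A N (v t)) - H (PhiN A N (uN N t))) < r].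
  have Q_freq M : exists N x, (M <= N)%N /\ Q N x.
    apply: contrapT => noN; apply: not_near.
    exists (maxn M (N0 A)) => // N /=; rewrite geq_max => /andP[MN AN].
    rewrite leNgt; apply/negP => /ereal_inf_lt[_ [v [v_sol v0 vrho] <-]].
    rewrite lte_fin => Jr; apply: noN.
    have [_ /W_lincombP[y ->] v0E] := v0.
    exists N, (y - b); split=> //; split=> //; exists v; split=> //.
      by rewrite addrC subrK.
    rewrite -vrho /g_; congr (normN A _); rewrite -v0E.
    have yE : y = b + (y - b) by rewrite addrC subrK.
    by rewrite [in RHS]yE PND// [RHS]addrAC subrr add0r.
  have [c c0 [M _ gM]] : exists2 c, 0 < c & \forall N \near \oo,
      forall x, c * `|x| <= g_ N x.
    apply: seminorm_eventually_bounded_below g_S g_cvg _ _.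
      by split=> [v w|a v]; rewrite /g ?linearD ?ler_normD// linearZ normrZ.
    by move=> x /normr0_eq0; exact: lincomb_eq0.
  have cK : compact [set x : 'rV[R]_s | `|x| <= rho / c].
    apply: bounded_closed_compact.
      exists (rho / c); split; first exact: num_real.
      by move=> k ck x /= /le_trans; apply; exact: ltW.
    apply: (closed_comp (f := fun x : 'rV[R]_s => `|x|)
      (D := [set y | y <= rho / c])).
      by move=> x _; exact: norm_continuous.
    exact: closed_le.
  have [|a Ka [x [xa xfreq]]] := compact_selection (Q := Q) cK.
    move=> M'; have [N [x [+ QNx]]] := Q_freq (maxn M' M).
    rewrite geq_max => /andP[M'N MN]; exists N, x; split=> //=.
    have cx := gM N MN x.
    rewrite ler_pdivlMr// mulrC; apply: le_trans cx _.
    by case: QNx => _ [v [_ _ ->]].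
  have g_x : g_ N (x N) @[N --> \oo] --> g a by exact: seminorm_cvg.
  (* [g_ N (x N)] equals [rho] infinitely often and converges to [g a]. *)
  have ga : g a = rho.
    apply/eqP/negPn/negP => ga; move/cvgrPdist_lt : g_x => /(_ `|g a - rho|).
    rewrite normr_gt0 subr_eq0 ga => /(_ isT)[M' _ gM'].
    have [N MN [_ [v [_ _ gN _]]]] := xfreq M'.
    by have := gM' N MN; rewrite /= gN ltxx.
  have [ex _ _] := ivp_well_posed.
  have [w w_sol w0] := ex _ (W_sub_D_B e_D_B (W_lincomb e (b + a))).
  have [v0 v0P] := traj_choice A_solvable (fun N => W_lincomb e (b + x N)).
  (* The witness trajectory where [Q] holds, and an arbitrary one from [v0] elsewhere. *)
  have [v vP] : exists v : forall N, R -> 'rV[R]_N, forall N, (N0 A <= N)%N ->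
      (ode_solution t1 A (v N) /\ v N 0 = PN A N (lincomb e (b + x N))) /\
      (Q N (x N) ->
        normY (fun t => H (PhiN A N (v N t)) - H (PhiN A N (uN N t))) < r).
    have vP N : {v : R -> 'rV[R]_N | (N0 A <= N)%N ->
      (ode_solution t1 A v /\ v 0 = PN A N (lincomb e (b + x N))) /\
      (Q N (x N) ->
        normY (fun t => H (PhiN A N (v t)) - H (PhiN A N (uN N t))) < r)}.
      apply: cid; have [QN|noQ] := pselect (Q N (x N)).
        by have [_ [v [v_sol vN0 _ vr]]] := QN; exists v.
      by exists (v0 N) => AN; split=> //; exact: v0P.
    by exists (fun N => sval (vP N)) => N; exact: (svalP (vP N)).
  have J_v := J_cvg x a v w xa (fun N AN => (vP N AN).1) w_sol w0.
  have J_ge : r < normY (fun t => H (w t) - H (u t)).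
    rewrite -lte_fin; apply: lt_le_trans r_lt _; apply: ereal_inf_lbound.
    exists w => //; split=> //; first by rewrite w0; exact: W_lincomb.
    by rewrite w0 u0 -linearB addrAC subrr add0r -ga.
  (* The distances converge to a limit above [r] but are below [r] infinitely often. *)
  move/cvgrPdist_lt : J_v.
  move=> /(_ (normY (fun t => H (w t) - H (u t)) - r)).
  rewrite subr_gt0 => /(_ J_ge)[M' _ JM'].
  have [N MN QN] := xfreq M'; have [AN _] := QN.
  have := JM' N MN; rewrite /= ltr_norml => /andP[_].
  by rewrite ltrD2l ltrN2 => /lt_trans/(_ ((vP N AN).2 QN)); rewrite ltxx.
(* Upper bound: [w] is a competitor whose output distance is below [r]. *)
- move=> /ereal_inf_lt[_ [w [w_sol w0_W w_rho] <-]]; rewrite lte_fin => Jr.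
  have [c w0] := (W_lincombP _ _).1 w0_W.
  pose a := c - b.
  have w0E : w 0 = lincomb e (b + a) by rewrite w0 /a addrC subrK.
  have ga : g a = rho by rewrite -w_rho w0 u0 -linearB.
  (* The factor makes the N-norm of the increment exactly [rho] once [g_ N a] is positive, and tends
     to 1 because [g a = rho]. *)
  pose x N := (rho / g_ N a) *: a.
  have g_a0 : g_ N a @[N --> \oo] --> rho by rewrite -ga; exact: g_cvg.
  have xa : x N @[N --> \oo] --> a.
    rewrite -[X in _ --> X]scale1r -(divff (lt0r_neq0 rho_gt0)).
    apply: cvgZr_tmp; apply: cvgM; first exact: cvg_cst.
    by apply: cvgV => //; exact: lt0r_neq0.
  have [v vP] := traj_choice A_solvable (fun N => W_lincomb e (b + x N)).
  have J_v := J_cvg x a v w xa vP w_sol w0E.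
  move/cvgrPdist_lt : J_v.
  move=> /(_ (r - normY (fun t => H (w t) - H (u t)))).
  rewrite subr_gt0 => /(_ Jr) J_near.
  have g_pos : \forall N \near \oo, 0 < g_ N a by exact: cvgr_gt g_a0 _ _.
  near=> N.
  have AN : (N0 A <= N)%N by near: N; exact: nbhs_infty_ge.
  have gN0 : 0 < g_ N a by near: N.
  have [v_sol v0] := vP N AN.
  apply: (@le_lt_trans _ _
    (normY (fun t => H (PhiN A N (v N t)) - H (PhiN A N (uN N t))))%:E).
    apply: ereal_inf_lbound; exists (v N) => //; split=> //.
      by rewrite v0; exists (lincomb e (b + x N)) => //; exact: W_lincomb.
    rewrite v0 PND// addrAC subrr add0r.
    rewrite [LHS](_ : _ = `|rho / g_ N a| * g_ N a); last first.
      exact: (normN_lincomb_seminorm e_D_B AN).2.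
    by rewrite ger0_norm ?divfK ?gt_eqF// divr_ge0// ltW.
  rewrite lte_fin.
  have : `|normY (fun t => H (w t) - H (u t)) -
    normY (fun t => H (PhiN A N (v N t)) - H (PhiN A N (uN N t)))| <
    r - normY (fun t => H (w t) - H (u t)) by near: N.
  by rewrite distrC ltr_norml => /andP[_]; rewrite ltrD2r.
Unshelve. all: by end_near. Qed.
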